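(* Let $\{a_n\}_{n\ge1}$ and $\{c_n\}_{n\ge1}$ be sequences of positive real numbers. (i) If $$\frac{a_n}{a_{n+1}}> 1+\frac{1}{n}+\frac{\theta_n+c_{n+1}}{n\ln(n)}$$ for all $n$ sufficiently large, for some sequence $\{\theta_n\}_{n\ge1}$ of real numbers and some real number $\theta$ such that $\theta_n\geq\theta>1$ for all $n\geq 1$, then $\sum c_n a_n$ converges. (ii) If $$\frac{a_n}{a_{n+1}}\leq 1+\frac{1}{n}+\frac{\theta_n-c_{n+1}}{n\ln(n)}$$ for all $n$ sufficiently large, for some sequence $\{\theta_n\}_{n\ge1}$ of real numbers and some real number $\theta$ such that $\theta_n\leq\theta<1$ for all $n\geq 1$, and if $\sum_{n\ge 2} \frac{c_n}{n\ln(n)}$ diverges, then $\sum c_n a_n$ diverges. *)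

(* Defs.v *)
From Stdlib Require Export Reals.
From Coquelicot Require Export Coquelicot.

(* Main.v *)
Require Import Defs.
From Stdlib Require Import Reals Lra Lia.
From Coquelicot Require Import Coquelicot.

Open Scope R_scope.

(** This is Kummer's test with the Bertrand weights [w n = n ln n]. Since
    [ln (n + 1) - ln n] lies between [1 / (n + 1)] and [1 / n],
    [w n + ln n + 1 <= w (n + 1) <= w n + ln n + 1 + 1 / n],
    and multiplying the ratio hypotheses by [w n * a (n + 1)] turns them into
    statements about the increments of [u n = w n * a n].

    In (i), as soon as [1 / n <= theta - 1], the increment of the weight is
    absorbed by [ln n + theta], and [c (n + 1) * a (n + 1) <= u n - u (n + 1)]:
    the series is dominated by a telescoping one with [u >= 0].

    In (ii), the weight grows by at least
    [ln n + 1 >= ln n + theta_ n - c (n + 1)], so [u] is eventually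
    nondecreasing, hence eventually bounded below by some [K > 0].
    Then [c n * a n >= K * (c n / w n)], and the series is compared with the
    divergent series of the [c n / w n]. *)

Definition bertrand_weight (n : nat) : R := INR n * ln (INR n).

Lemma ln_le_sub1 (x : R) : 0 < x -> ln x <= x - 1.
Proof.
  intros Hx.
  pose proof (exp_ineq1_le (ln x)) as H.
  rewrite exp_ln in H; lra.
Qed.

Lemma ln_succ_sub_le (x : R) : 0 < x -> ln (x + 1) - ln x <= 1 / x.
Proof.
  intros Hx.
  rewrite <- ln_div by lra.
  replace (1 / x) with ((x + 1) / x - 1) by (field; lra).
  apply ln_le_sub1, Rdiv_lt_0_compat; lra.
Qed.

Lemma ln_succ_sub_ge (x : R) : 0 < x -> 1 / (x + 1) <= ln (x + 1) - ln x.
Proof.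
  intros Hx.
  assert (H : ln (x / (x + 1)) <= x / (x + 1) - 1)
    by (apply ln_le_sub1, Rdiv_lt_0_compat; lra).
  rewrite ln_div in H by lra.
  replace (1 / (x + 1)) with (1 - x / (x + 1)) by (field; lra).
  lra.
Qed.

Lemma bertrand_weight_gt0 (n : nat) : (2 <= n)%nat -> 0 < bertrand_weight n.
Proof.
  intros Hn; apply le_INR in Hn; simpl in Hn.
  apply Rmult_lt_0_compat; [lra |].
  rewrite <- ln_1; apply ln_increasing; lra.
Qed.

Lemma bertrand_weight_succ_le (n : nat) : (1 <= n)%nat ->
  bertrand_weight (n + 1) <= bertrand_weight n + ln (INR n) + 1 + 1 / INR n.
Proof.
  intros Hn; apply le_INR in Hn; simpl in Hn.
  unfold bertrand_weight; rewrite plus_INR; simpl.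
  set (x := INR n) in *.
  assert (H : (x + 1) * (ln (x + 1) - ln x) <= (x + 1) * (1 / x))
    by (apply Rmult_le_compat_l; [lra | apply ln_succ_sub_le; lra]).
  replace ((x + 1) * (1 / x)) with (1 + 1 / x) in H by (field; lra).
  lra.
Qed.

Lemma bertrand_weight_succ_ge (n : nat) : (1 <= n)%nat ->
  bertrand_weight n + ln (INR n) + 1 <= bertrand_weight (n + 1).
Proof.
  intros Hn; apply le_INR in Hn; simpl in Hn.
  unfold bertrand_weight; rewrite plus_INR; simpl.
  set (x := INR n) in *.
  assert (H : (x + 1) * (1 / (x + 1)) <= (x + 1) * (ln (x + 1) - ln x))
    by (apply Rmult_le_compat_l; [lra | apply ln_succ_sub_ge; lra]).
  replace ((x + 1) * (1 / (x + 1))) with 1 in H by (field; lra).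
  lra.
Qed.

(** Clearing denominators puts the ratio hypotheses in Kummer's form. *)
Lemma bertrand_bound_mul (n : nat) (s y : R) : (2 <= n)%nat ->
  (1 + 1 / INR n + s / (INR n * ln (INR n))) * (bertrand_weight n * y)
  = (bertrand_weight n + ln (INR n) + s) * y.
Proof.
  intros Hn.
  pose proof (bertrand_weight_gt0 n Hn) as Hw; unfold bertrand_weight in *.
  field; split; intros E; rewrite E in Hw; lra.
Qed.

(** The partial sums from [N] on are bounded by [u N]: they telescope to
    [u N - u m], and [u m >= 0]. *)
Lemma ex_series_le_telescope (f u : nat -> R) (N : nat) :
  (forall n, (N <= n)%nat -> 0 <= f n) ->
  (forall n, (N <= n)%nat -> 0 <= u n) ->
  (forall n, (N <= n)%nat -> f n <= u n - u (n + 1)%nat) ->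
  ex_series f.
Proof.
  intros Hf Hu Hfu.
  apply (ex_series_incr_n f N).
  apply ex_finite_lim_seq_incr with (M := u N).
  - intros n; rewrite sum_Sn; unfold plus; simpl.
    specialize (Hf (N + S n)%nat ltac:(lia)); lra.
  - intros m.
    enough (H : sum_n (fun k => f (N + k)%nat) m <= u N - u (N + m + 1)%nat)
      by (specialize (Hu (N + m + 1)%nat ltac:(lia));
          apply (Rle_trans _ _ _ H); lra).
    induction m as [|m IH].
    + rewrite sum_O, Nat.add_0_r; apply Hfu; lia.
    + rewrite sum_Sn; unfold plus; simpl.
      specialize (Hfu (N + S m)%nat ltac:(lia)).
      replace (N + m + 1)%nat with (N + S m)%nat in IH by lia.
      lra.
Qed.

Lemma eventually_nondecreasing_ge (u : nat -> R) (N : nat) :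
  (forall n, (N <= n)%nat -> u n <= u (n + 1)%nat) ->
  forall n, (N <= n)%nat -> u N <= u n.
Proof.
  intros Hu n Hn; induction Hn as [|n Hn IH]; [lra |].
  specialize (Hu n Hn); rewrite Nat.add_1_r in Hu; lra.
Qed.

(* Sequences (x_n)_{n>=1} are functions nat -> R whose value at 0 is never
   used: the series over n >= 1 (resp. n >= 2) are shifted by 1 (resp. 2). *)
Theorem theorem4p2 :
  forall a c : nat -> R,
    (forall n : nat, (1 <= n)%nat -> 0 < a n) ->
    (forall n : nat, (1 <= n)%nat -> 0 < c n) ->
    ((exists (theta_ : nat -> R) (theta : R),
        1 < theta /\
        (forall n : nat, (1 <= n)%nat -> theta <= theta_ n) /\
        eventually (fun n : nat =>
          a n / a (n + 1)%nat >
          1 + 1 / INR n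
            + (theta_ n + c (n + 1)%nat) / (INR n * ln (INR n)))) ->
      ex_series (fun n : nat => c (n + 1)%nat * a (n + 1)%nat))
    /\
    ((exists (theta_ : nat -> R) (theta : R),
        theta < 1 /\
        (forall n : nat, (1 <= n)%nat -> theta_ n <= theta) /\
        eventually (fun n : nat =>
          a n / a (n + 1)%nat <=
          1 + 1 / INR n
            + (theta_ n - c (n + 1)%nat) / (INR n * ln (INR n)))) ->
      ~ ex_series (fun n : nat =>
          c (n + 2)%nat / (INR (n + 2) * ln (INR (n + 2)))) ->
      ~ ex_series (fun n : nat => c (n + 1)%nat * a (n + 1)%nat)).
Proof.
  intros a c Ha Hc; split.
  - intros (theta_ & theta & Htheta & Htheta_ & [N HN]).
    (* [M] is chosen so that [1 / n <= theta - 1] for [n > M]. *)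
    destruct (nfloor_ex (/ (theta - 1))) as [M [_ HM]];
      [left; apply Rinv_0_lt_compat; lra |].
    apply (ex_series_le_telescope _ (fun n => bertrand_weight n * a n)
             (N + M + 2)).
    + intros n _; left; apply Rmult_lt_0_compat; [apply Hc | apply Ha]; lia.
    + intros n Hn; left.
      apply Rmult_lt_0_compat; [apply bertrand_weight_gt0 | apply Ha]; lia.
    + intros n Hn.
      specialize (HN n ltac:(lia)); specialize (Htheta_ n ltac:(lia)).
      pose proof (Ha (n + 1)%nat ltac:(lia)) as Ha1.
      pose proof (bertrand_weight_gt0 n ltac:(lia)) as Hw.
      pose proof (bertrand_weight_succ_le n ltac:(lia)) as Hw1.
      assert (Hn_inv : 1 / INR n <= theta - 1).
      { unfold Rdiv; rewrite Rmult_1_l, <- (Rinv_inv (theta - 1)).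
        apply Rinv_le_contravar; [apply Rinv_0_lt_compat; lra |].
        assert (INR (M + 1) <= INR n) by (apply le_INR; lia).
        rewrite plus_INR in *; simpl in *; lra. }
      apply Rgt_lt, (Rmult_lt_compat_r (bertrand_weight n * a (n + 1)%nat)) in HN;
        [| apply Rmult_lt_0_compat; assumption].
      rewrite bertrand_bound_mul in HN by lia.
      replace (a n / a (n + 1)%nat * (bertrand_weight n * a (n + 1)%nat))
        with (bertrand_weight n * a n) in HN by (field; lra).
      assert (bertrand_weight (n + 1) * a (n + 1)%nat
              <= (bertrand_weight n + ln (INR n) + theta_ n) * a (n + 1)%nat)
        by (apply Rmult_le_compat_r; lra).
      lra.
  - intros (theta_ & theta & Htheta & Htheta_ & [N HN]) Hdiv Hconv.
    apply Hdiv.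
    set (u := fun n => bertrand_weight n * a n).
    assert (Hu : forall n, (N + 2 <= n)%nat -> u n <= u (n + 1)%nat).
    { intros n Hn; unfold u.
      specialize (HN n ltac:(lia)); specialize (Htheta_ n ltac:(lia)).
      pose proof (Ha (n + 1)%nat ltac:(lia)) as Ha1.
      pose proof (Hc (n + 1)%nat ltac:(lia)) as Hc1.
      pose proof (bertrand_weight_gt0 n ltac:(lia)) as Hw.
      pose proof (bertrand_weight_succ_ge n ltac:(lia)) as Hw1.
      apply (Rmult_le_compat_r (bertrand_weight n * a (n + 1)%nat)) in HN;
        [| left; apply Rmult_lt_0_compat; assumption].
      rewrite bertrand_bound_mul in HN by lia.
      replace (a n / a (n + 1)%nat * (bertrand_weight n * a (n + 1)%nat))
        with (bertrand_weight n * a n) in HN by (field; lra).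
      apply (Rle_trans _ _ _ HN), Rmult_le_compat_r; lra. }
    set (K := u (N + 2)%nat).
    assert (HK : 0 < K).
    { apply Rmult_lt_0_compat; [apply bertrand_weight_gt0 | apply Ha]; lia. }
    apply (ex_series_incr_n _ N).
    apply (@ex_series_le R_AbsRing R_CompleteNormedModule) with
      (b := fun n => / K * (c (N + 1 + n + 1)%nat * a (N + 1 + n + 1)%nat)).
    + intros n; change norm with Rabs.
      replace (N + 1 + n + 1)%nat with (N + n + 2)%nat by lia.
      set (m := (N + n + 2)%nat).
      pose proof (eventually_nondecreasing_ge u (N + 2) Hu m ltac:(lia)) as Hm.
      fold K in Hm; unfold u in Hm.
      pose proof (bertrand_weight_gt0 m ltac:(lia)) as Hw.
      pose proof (Hc m ltac:(lia)) as Hcm.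
      fold (bertrand_weight m).
      rewrite Rabs_pos_eq by (left; apply Rdiv_lt_0_compat; assumption).
      replace (c m / bertrand_weight m)
        with (/ K * (c m / bertrand_weight m * K)) by (field; lra).
      apply Rmult_le_compat_l; [left; apply Rinv_0_lt_compat; exact HK |].
      replace (c m * a m)
        with (c m / bertrand_weight m * (bertrand_weight m * a m))
        by (field; lra).
      apply Rmult_le_compat_l; [left; apply Rdiv_lt_0_compat |]; assumption.
    + apply (ex_series_scal_l (/ K)
               (fun n => c (N + 1 + n + 1)%nat * a (N + 1 + n + 1)%nat)).
      apply (ex_series_incr_n (fun n => c (n + 1)%nat * a (n + 1)%nat) (N + 1)).
      exact Hconv.
Qed.
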